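(* Let $a > b > 0$ be real numbers and let $A$ be a complex $n \times n$ matrix whose spectrum belongs to $$\mathcal{E}_e = \left\{\lambda \in \mathbb{C} : \frac{(\mathrm{Re}\,\lambda)^2}{a^2} + \frac{(\mathrm{Im}\,\lambda)^2}{b^2} > 1 \right\}.$$ Let $H = H^* > 0$ be a solution to $$H - \left(\frac{1}{2a^2}+\frac{1}{2b^2}\right) A^*HA - \left(\frac{1}{4a^2}-\frac{1}{4b^2}\right)\left(HA^2+(A^* )^2H\right) = -I.$$ If $B$ is a complex $n \times n$ matrix such that $$-I < \left(\frac{1}{2a^2}+\frac{1}{2b^2}\right) \left(B^*HA + A^*HB + B^*HB\right) + \left(\frac{1}{4a^2}-\frac{1}{4b^2}\right)\left(H(AB + BA + B^2) + (AB + BA + B^2)^*H\right),$$ then the spectrum of the matrix $A + B$ also belongs to $\mathcal{E}_e$.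
   Context: $M^*$ denotes the conjugate transpose of $M$, and $I$ is the $n\times n$ identity matrix. For Hermitian matrices $M, N$, $M > 0$ means that $M$ is positive definite and $M < N$ means that $N - M$ is positive definite. *)

(* Defs.v *)
From mathcomp Require Import all_boot all_order all_algebra.
From mathcomp Require Export spectral sesquilinear reals complex.

Set Implicit Arguments.
Unset Strict Implicit.
Unset Printing Implicit Defensive.

Import Order.TTheory GRing.Theory Num.Theory.
Local Open Scope ring_scope.
Local Open Scope complex_scope.
Local Open Scope sesquilinear_scope.

Definition ellipse_ext (R : realType) (a b : R) (l : R[i]) : Prop :=
  1 < (complex.Re l) ^+ 2 / a ^+ 2 + (complex.Im l) ^+ 2 / b ^+ 2.

(* [eigenvalue] is defined through row eigenvectors; the left and right
   spectra of a square matrix coincide. *)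
Definition spectrum_in (R : realType) (n : nat) (M : 'M[R[i]]_n)
    (E : R[i] -> Prop) : Prop :=
  forall l : R[i], eigenvalue M l -> E l.

(* In the order on [R[i]], [0 < z] says that [z] is real and positive. *)
Definition posdefmx (R : realType) (n : nat) (M : 'M[R[i]]_n) : Prop :=
  M \is hermsymmx /\
  forall x : 'cV[R[i]]_n, x != 0 -> 0 < (x ^t* *m M *m x) 0 0.

(* The strict Loewner order, meant for Hermitian [M] and [N]. *)
Definition ltmx_posdef (R : realType) (n : nat) (M N : 'M[R[i]]_n) : Prop :=
  posdefmx (N - M).

(* Main.v *)
Require Import Defs.
From mathcomp Require Import all_boot all_order all_algebra.
From mathcomp Require Import ring.

(* With [L(M) = p M^* H M + q (H M^2 + M^* M^* H)], the two hypotheses combine to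
   [L(A + B) - H > 0].  If [(A + B) x = l x], then
   [x^* L(A + B) x = (p |l|^2 + 2 q Re(l^2)) x^* H x], and for the given [p], [q]
   the scalar is [(Re l)^2/a^2 + (Im l)^2/b^2]; as [x^* H x > 0], it exceeds 1. *)

Set Implicit Arguments.
Unset Strict Implicit.
Unset Printing Implicit Defensive.

Import Order.TTheory GRing.Theory Num.Theory.
Local Open Scope ring_scope.
Local Open Scope complex_scope.
Local Open Scope sesquilinear_scope.

Lemma char_poly_trmx (F : comNzRingType) (n : nat) (M : 'M[F]_n) :
  char_poly M^T = char_poly M.
Proof.
rewrite /char_poly -[RHS]det_tr; congr (\det _).
by apply/matrixP=> i j; rewrite !mxE eq_sym.
Qed.

(** [M] and [M^T] share their characteristic polynomial, so [l] has a row eigenvector for [M^T]; its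
    transpose is a column eigenvector for [M], as the forms [x ^t* *m N *m x] require. *)
Lemma eigenvalue_colP (F : fieldType) (n : nat) (M : 'M[F]_n) (l : F) :
  eigenvalue M l -> exists2 x : 'cV_n, x != 0 & M *m x = l *: x.
Proof.
rewrite eigenvalue_root_char -char_poly_trmx -eigenvalue_root_char.
case/eigenvalueP=> v Mv v0; exists v^T; first by rewrite trmx_eq0.
by rewrite -[M]trmxK -trmx_mul Mv linearZ.
Qed.

Section LyapunovOperator.
Variables (C : numClosedFieldType) (n : nat) (p q : C) (H : 'M[C]_n).

Lemma adjmxM (k m r : nat) (M : 'M[C]_(k, m)) (N : 'M[C]_(m, r)) :
  (M *m N) ^t* = N ^t* *m M ^t*.
Proof. by rewrite trmx_mul map_mxM. Qed.

Lemma adjmxD (k m : nat) (M N : 'M[C]_(k, m)) : (M + N) ^t* = M ^t* + N ^t*.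
Proof. by rewrite linearD map_mxD. Qed.

Definition lyapmx (M : 'M[C]_n) : 'M[C]_n :=
  p *: (M ^t* *m H *m M) + q *: (H *m (M *m M) + (M ^t* *m M ^t*) *m H).

(** The square contributes [A *m B + B *m A + B *m B], in both orders since [A] and [B] may fail to
    commute. The increment is kept in the shape of the hypothesis on [B]. *)
Lemma lyapmxD (A B : 'M[C]_n) :
  lyapmx (A + B) = lyapmx A
    + (p *: (B ^t* *m H *m A + A ^t* *m H *m B + B ^t* *m H *m B)
       + q *: (H *m (A *m B + B *m A + B *m B)
               + (A *m B + B *m A + B *m B) ^t* *m H)).
Proof.
rewrite /lyapmx !adjmxD !adjmxM !(mulmxDl, mulmxDr) !mulmxA !scalerDr.
apply/matrixP=> i j; rewrite !mxE; ring.
Qed.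

(** Each [M] meeting [x] turns into [l], and each [M ^t*] meeting [x ^t*] into [l^*]. *)
Lemma lyapmx_eigen (M : 'M[C]_n) (l : C) (x : 'cV[C]_n) : M *m x = l *: x ->
  x ^t* *m lyapmx M *m x
  = (p * (l^* * l) + q * (l ^+ 2 + l^* ^+ 2)) *: (x ^t* *m H *m x).
Proof.
move=> Mx; have xM : x ^t* *m M ^t* = l^* *: x ^t*.
  by rewrite -adjmxM Mx linearZ map_mxZ.
have e1 : x ^t* *m (M ^t* *m H *m M) *m x = (l^* * l) *: (x ^t* *m H *m x).
  by rewrite !mulmxA xM -(mulmxA _ M x) Mx -!scalemxAl -scalemxAr scalerA.
have e2 : x ^t* *m (H *m (M *m M)) *m x = l ^+ 2 *: (x ^t* *m H *m x).
  rewrite !mulmxA -(mulmxA _ M x) Mx -scalemxAr -(mulmxA _ M x) Mx -scalemxAr.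
  by rewrite scalerA expr2.
have e3 : x ^t* *m (M ^t* *m M ^t* *m H) *m x = l^* ^+ 2 *: (x ^t* *m H *m x).
  by rewrite !mulmxA xM -!scalemxAl xM -!scalemxAl scalerA expr2.
rewrite /lyapmx mulmxDr mulmxDl -!scalemxAr -!scalemxAl mulmxDr mulmxDl e1 e2 e3.
by rewrite -scalerDl !scalerA -scalerDl.
Qed.

End LyapunovOperator.

Theorem theorem7 (R : realType) (n : nat) (a b : R) (A H B : 'M[R[i]]_n)
  (b_gt0 : 0 < b) (b_lt_a : b < a)
  (specA : spectrum_in A (ellipse_ext a b))
  (H_posdef : posdefmx H)
  (H_eq :
    H
    - (1 / (2 * a ^+ 2) + 1 / (2 * b ^+ 2))%:C *: (A ^t* *m H *m A)
    - (1 / (4 * a ^+ 2) - 1 / (4 * b ^+ 2))%:C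
        *: (H *m (A *m A) + (A ^t* *m A ^t*) *m H)
    = - 1%:M)
  (B_small :
    ltmx_posdef (- 1%:M)
      ((1 / (2 * a ^+ 2) + 1 / (2 * b ^+ 2))%:C
         *: (B ^t* *m H *m A + A ^t* *m H *m B + B ^t* *m H *m B)
       + (1 / (4 * a ^+ 2) - 1 / (4 * b ^+ 2))%:C
         *: (H *m (A *m B + B *m A + B *m B)
             + (A *m B + B *m A + B *m B) ^t* *m H))) :
  spectrum_in (A + B) (ellipse_ext a b).
Proof.
have a_gt0 : 0 < a by exact: lt_trans b_lt_a.
move=> l /eigenvalue_colP[x x0 Cx].
have hx := H_posdef.2 x x0.
set p := (_ + _)%:C in H_eq B_small; set q := (_ - _)%:C in H_eq B_small.
have L1 : lyapmx p q H A - H = 1%:M.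
  by rewrite -[RHS]opprK -H_eq !opprB addrA [X in _ = X - _]addrC.
have := B_small.2 x x0.
(* Writing [1%:M] as [lyapmx p q H A - H] absorbs the increment into [lyapmx p q H (A + B) - H]. *)
rewrite opprK -L1 addrA [X in X - _]addrC -lyapmxD.
rewrite mulmxBr mulmxBl (lyapmx_eigen _ _ _ Cx).
(* Only the outer layers of the entry are unfolded, so that [x ^t* *m H *m x] stays as in [hx] and
   its positive entry can be cancelled. *)
rewrite [X in 0 < X]mxE [X in 0 < X + _]mxE [X in 0 < _ + X]mxE.
rewrite -[X in _ - X]mul1r -mulrBl pmulr_lgt0 // subr_gt0.
case: l Cx => u v _.
(* The scalar is [p (u^2 + v^2) + 2 q (u^2 - v^2)], with [p + 2 q = 1/a^2] and [p - 2 q = 1/b^2]. *)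
have -> : p * ((u +i* v)^* * (u +i* v))
          + q * ((u +i* v) ^+ 2 + (u +i* v)^* ^+ 2)
        = (u ^+ 2 / a ^+ 2 + v ^+ 2 / b ^+ 2)%:C.
  rewrite !expr2; apply/eqP; rewrite eq_complex /=.
  apply/andP; split; apply/eqP; field; first by rewrite !gt_eqF.
  by rewrite !gt_eqF.
by rewrite ltcR.
Qed.
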